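(* Let $\mathcal{H}_A,\mathcal{H}_B$ be finite-dimensional Hilbert spaces with fixed reference bases $\{|i\rangle_A\}$ and $\{|j\rangle_B\}$, and equip $\mathcal{H}_A\otimes\mathcal{H}_B$ with the product reference basis $\{|i\rangle_A|j\rangle_B\}$. For every state $\rho_{AB}$ on $\mathcal{H}_A\otimes\mathcal{H}_B$ with reduced states $\rho_A,\rho_B$, $$C_f(\rho_{AB})\geq \max\{C_r(\rho_A)+C_f(\rho_B),\ C_r(\rho_B)+C_f(\rho_A)\}+E_f(\rho_{AB}).$$
   Context: $S(\rho)=-\mathrm{Tr}\,\rho\log\rho$ is the von Neumann entropy. For a system with reference basis $\{|k\rangle\}$, $\Delta(\rho)=\sum_k |k\rangle\langle k|\rho|k\rangle\langle k|$ is the completely dephasing map. The relative entropy of coherence is $C_r(\rho)=S(\Delta(\rho))-S(\rho)$. The coherence of formation is $C_f(\rho)=\min\sum_i p_i S(\Delta(|\psi_i\rangle\langle\psi_i|))$, the minimum over all pure-state decompositions $\rho=\sum_i p_i|\psi_i\rangle\langle\psi_i|$ (for bipartite states, $\Delta$ is taken with respect to the product basis). The entanglement of formation is $E_f(\rho_{AB})=\min\sum_i p_i S(\mathrm{Tr}_A|\psi_i\rangle\langle\psi_i|_{AB})$, minimized over all pure-state decompositions $\rho_{AB}=\sum_ip_i|\psi_i\rangle\langle\psi_i|_{AB}$. *)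

(* Defs.v *)
From HB Require Import structures.
From mathcomp Require Import all_boot all_order all_algebra.
From mathcomp Require Import complex.
From mathcomp Require Import classical_sets reals exp.

Set Implicit Arguments.
Unset Strict Implicit.
Unset Printing Implicit Defensive.
Import Order.TTheory GRing.Theory Num.Theory.
Local Open Scope ring_scope.
Local Open Scope classical_set_scope.

Section Quantum.
Variable R : realType.
Local Notation C := R[i].

Definition adj (m n : nat) (A : 'M[C]_(m, n)) : 'M[C]_(n, m) :=
  (map_mx (@conjc R) A)^T.

Definition is_state (n : nat) (rho : 'M[C]_n) : Prop :=
  [/\ adj rho = rho,
      (forall v : 'cV[C]_n, 0 <= (adj v *m rho *m v) 0 0)
    & \tr rho = 1].

(* eigenvalues (with multiplicity) = roots of the characteristic polynomial;
   the multiset is unique, its enumeration order is irrelevant below *)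
Definition eigvals (n : nat) (A : 'M[C]_n) : seq C :=
  projT1 (closed_field_poly_normal (char_poly A)).

(* von Neumann entropy S(rho) = - Tr rho log rho = - sum_k l_k ln l_k
   (with 0 ln 0 = 0, since ln 0 = 0 in MathComp-Analysis) *)
Definition vn_entropy (n : nat) (A : 'M[C]_n) : R :=
  - \sum_(z <- eigvals A) (complex.Re z * ln (complex.Re z)).

Definition dephase (n : nat) (A : 'M[C]_n) : 'M[C]_n :=
  diag_mx (\row_k A k k).

Definition coh_rel (n : nat) (rho : 'M[C]_n) : R :=
  vn_entropy (dephase rho) - vn_entropy rho.

Definition proj (n : nat) (psi : 'cV[C]_n) : 'M[C]_n := psi *m adj psi.

Definition pure_decomp (n : nat) (rho : 'M[C]_n) (k : nat)
  (p : 'I_k -> R) (psi : 'I_k -> 'cV[C]_n) : Prop :=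
  [/\ forall i, 0 <= p i,
      \sum_i p i = 1,
      forall i, adj (psi i) *m psi i = 1%:M
    & rho = \sum_i (real_complex R (p i)) *: proj (psi i)].

Definition roof (n : nat) (f : 'cV[C]_n -> R) (rho : 'M[C]_n) : R :=
  inf [set x | exists k (p : 'I_k -> R) (psi : 'I_k -> 'cV[C]_n),
        pure_decomp rho p psi /\ x = \sum_i p i * f (psi i)].

Definition coh_form (n : nat) (rho : 'M[C]_n) : R :=
  roof (fun psi => vn_entropy (dephase (proj psi))) rho.

(* bipartite system H_A (dim m) ⊗ H_B (dim n); product basis index
   |i>_A|j>_B  <-> mxvec_index i j *)
Definition ptraceB (m n : nat) (A : 'M[C]_(m * n)) : 'M[C]_m :=
  \matrix_(i, i') \sum_(j < n) A (mxvec_index i j) (mxvec_index i' j).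

Definition ptraceA (m n : nat) (A : 'M[C]_(m * n)) : 'M[C]_n :=
  \matrix_(j, j') \sum_(i < m) A (mxvec_index i j) (mxvec_index i j').

Definition ent_form (m n : nat) (rho : 'M[C]_(m * n)) : R :=
  roof (fun psi : 'cV[C]_(m * n) => vn_entropy (@ptraceA m n (proj psi))) rho.

End Quantum.

Arguments ptraceA {R} m n A.
Arguments ptraceB {R} m n A.
Arguments ent_form {R} m n rho.

(* Main.v *)
(* Let psi be a pure state occurring in a decomposition of rho, with coefficient
   matrix M. The chain rule H(JK) = H(J) + H(K|J) for the outcomes of the product
   reference basis splits the coherence of psi: H(J) is the entropy of the dephased
   reduced state M M^*, and H(K|J) is the average coherence of the states into which
   the outcomes J steer the other party, hence at least its coherence of formation.
   Writing H(J) = C_r(M M^* ) + S(M M^* ), averaging over the decomposition and using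
   convexity of C_r gives the bound, as S(M M^* ) = S(M^* M).

   Convexity of C_r amounts to D(A || B) >= D(diag A || diag B) whenever A is dominated
   by a multiple of B. It is proved without Lieb's theorem: for each t > 0 the
   quantity tr A (L_B + t R_A)^-1 A dominates its diagonal analogue, by restricting a
   variational formula to diagonal matrices. This says that
   F(t) = sum_ab w_ab l_a ln(m_b + t l_a) - sum_k p_k ln(q_k + t p_k) is
   nondecreasing, and the claim is F(0) <= lim_{t -> oo} F(t). Here l_a, m_b are the
   eigenvalues of A and B, w_ab the squared overlaps of their eigenvectors, and
   p_k, q_k their diagonal entries. *)
Require Import Defs.
From HB Require Import structures.
From mathcomp Require Import all_boot all_order all_algebra.
From mathcomp Require Import complex spectral.
From mathcomp Require Import boolp classical_sets functions reals topology.
From mathcomp Require Import normedtype derive realfun exp.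
From mathcomp Require Import ring lra.
Set Implicit Arguments.
Unset Strict Implicit.
Unset Printing Implicit Defensive.
Import Order.TTheory GRing.Theory Num.Theory.
Import numFieldNormedType.Exports.
Local Open Scope ring_scope.

(** * From resolvents to logarithms *)

Section Calculus.
Variable R : realType.

Lemma is_derive_bigsum (I : Type) (r : seq I) (f : I -> R -> R) (df : I -> R) (t : R) :
  (forall i, is_derive t 1 (f i) (df i)) ->
  is_derive t 1 (fun s => \sum_(i <- r) f i s) (\sum_(i <- r) df i).
Proof.
move=> fP; elim: r => [|i r IH].
  rewrite big_nil; rewrite [X in is_derive _ _ X](_ : _ = cst 0); first exact: is_derive_cst.
  by apply/funext => s; rewrite big_nil.
rewrite big_cons; rewrite [X in is_derive _ _ X](_ : _ = f i + (fun s => \sum_(i <- r) f i s)).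
  exact: is_deriveD.
by apply/funext => s; rewrite big_cons.
Qed.

(** Positivity of [y] is asked only for [c != 0]: a term of zero weight is constant, even where its
    logarithm has argument 0. *)
Lemma is_derive_ln_affine (c x y t : R) : 0 <= x -> 0 <= y -> 0 <= t ->
  (c != 0 -> 0 < y) ->
  is_derive t 1 (fun s => c * ln (y + s * x)) (c * x / (y + t * x)).
Proof.
move=> x0 y0 t0; have [->|cn0 /(_ isT) yp] := eqVneq c 0.
  move=> _; rewrite !mul0r [X in is_derive _ _ X](_ : _ = cst 0); first exact: is_derive_cst.
  by apply/funext => s; rewrite mul0r.
have yt : 0 < y + t * x by rewrite ltr_wpDr ?mulr_ge0.
have dl : is_derive (y + t * x) 1 (@ln R) (y + t * x)^-1 := is_derive1_ln yt.
have da : is_derive t 1 (fun s => y + s * x) x.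
  rewrite [X in is_derive _ _ X](_ : _ = cst y + x *: (id : R -> R)); last first.
    by apply/funext => s; rewrite [s * x]mulrC.
  have := is_deriveD (is_derive_cst y t 1) (is_deriveZ x (is_derive_id t 1)).
  by rewrite add0r scaler1.
rewrite [X in is_derive _ _ X](_ : _ = c *: (@ln R \o (fun s => y + s * x))); last exact/funext.
have := is_deriveZ c (@is_derive1_comp R _ (fun s => y + s * x) t _ _ dl da).
rewrite [X in is_derive _ _ _ X](_ : _ = c * x / (y + t * x)) //.
by rewrite [LHS]mulrA mulrAC.
Qed.

(** The two sides of the resolvent inequality differ by the derivative of [F], so [F] is
    nondecreasing. The equal total masses cancel the [ln t] growth of its two sums, which leaves
    [x ln x] and [p ln p] in the limit. The support hypotheses make [F] differentiable down to
    [t = 0]. *)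
Lemma log_sum_of_resolvent (I J : finType) (w x y : I -> R) (p q : J -> R) :
  (forall i, 0 <= w i) -> (forall i, 0 <= x i) -> (forall i, 0 <= y i) ->
  (forall k, 0 <= p k) -> (forall k, 0 <= q k) ->
  (forall i, y i = 0 -> w i * x i = 0) -> (forall k, q k = 0 -> p k = 0) ->
  \sum_i w i * x i = \sum_k p k ->
  (forall t : R, 0 < t -> \sum_k p k ^+ 2 / (q k + t * p k)
                        <= \sum_i w i * x i ^+ 2 / (y i + t * x i)) ->
  \sum_k p k * (ln (p k) - ln (q k)) <= \sum_i w i * x i * (ln (x i) - ln (y i)).
Proof.
move=> w0 x0 y0 p0 q0 y0wx q0p wxp res.
pose F (t : R) := \sum_i w i * x i * ln (y i + t * x i) - \sum_k p k * ln (q k + t * p k).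
pose dF (t : R) := \sum_i w i * x i * x i / (y i + t * x i) - \sum_k p k * p k / (q k + t * p k).
have FP (t : R) : 0 <= t -> is_derive t 1 F (dF t).
  move=> t0; apply: is_deriveB; apply: is_derive_bigsum => i; apply: is_derive_ln_affine => //.
    by rewrite lt_neqAle y0 andbT; apply: contraNN => /eqP/esym/y0wx/eqP.
  by rewrite lt_neqAle q0 andbT; apply: contraNN => /eqP/esym/q0p/eqP.
have F_mono (t : R) : 0 <= t -> F 0 <= F t.
  move=> t0; apply: (@ger0_derive1_ndecry R F 0) => //.
  - by move=> s; rewrite in_itv /= andbT => /ltW s0; have [] := FP s s0.
  - move=> s; rewrite in_itv /= andbT => s0; have := FP s (ltW s0) => dFs.
    rewrite derive1E (@derive_val _ _ _ _ _ _ _ dFs) subr_ge0.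
    have := res s s0; under eq_bigr do rewrite expr2.
    by under [in leRHS]eq_bigr do rewrite expr2 mulrA.
  - apply: derivable_within_continuous => s; rewrite in_itv /= andbT => s0.
    by have [] := FP s s0.
(* The limit at infinity with an explicit error: [ln (y + t x) = ln t + ln x + ln (1 + y / (t x))]
   with [ln (1 + u) <= u], while [ln (q + t p) >= ln t + ln p]. *)
have F_ub (t : R) : 0 < t -> F t <=
    \sum_i w i * x i * ln (x i) - \sum_k p k * ln (p k) + (\sum_i w i * y i) / t.
  move=> t0.
  have A : \sum_i w i * x i * ln (y i + t * x i) <=
      \sum_i (w i * x i * ln t + w i * x i * ln (x i) + w i * y i / t).
    apply: ler_sum => i _; have [wx0|wx0] := eqVneq (w i * x i) 0.
      by rewrite wx0 !mul0r !add0r divr_ge0 ?mulr_ge0 ?(ltW t0).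
    have xi : 0 < x i.
      by rewrite lt_neqAle x0 andbT eq_sym; apply: contraNN wx0 => /eqP->; rewrite mulr0.
    have -> : y i + t * x i = t * x i * (1 + y i / (t * x i)).
      by field; rewrite (gt_eqF t0) (gt_eqF xi).
    have yi : 0 <= y i / (t * x i) by rewrite divr_ge0 // mulr_ge0 // ltW.
    rewrite !lnM ?posrE ?mulr_gt0 //; last by rewrite ltr_wpDr.
    rewrite !mulrDr lerD2l.
    apply: (@le_trans _ _ (w i * x i * (y i / (t * x i)))).
      by rewrite ler_wpM2l ?mulr_ge0 // le_ln1Dx // (lt_le_trans _ yi) // ltrN10.
    by rewrite le_eqVlt; apply/orP; left; apply/eqP; field; rewrite (gt_eqF t0) (gt_eqF xi).
  have B : \sum_k (p k * ln t + p k * ln (p k)) <= \sum_k p k * ln (q k + t * p k).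
    apply: ler_sum => k _; have [->|pk0] := eqVneq (p k) 0; first by rewrite !mul0r addr0.
    have pk : 0 < p k by rewrite lt_neqAle eq_sym pk0 p0.
    rewrite -mulrDr -lnM ?posrE // ler_wpM2l // ler_ln ?posrE ?mulr_gt0 // ?lerDr //.
    by rewrite ltr_wpDl // mulr_gt0.
  move: A B; rewrite !big_split /= -!mulr_suml wxp /F => A B; lra.
have F0 : F 0 = \sum_i w i * x i * ln (y i) - \sum_k p k * ln (q k).
  by congr (_ - _); apply: eq_bigr => i _; rewrite mul0r addr0.
have main : F 0 <= \sum_i w i * x i * ln (x i) - \sum_k p k * ln (p k).
  apply/ler_addgt0Pr => e e0.
  have K0 : 0 <= \sum_i w i * y i by apply: sumr_ge0 => i _; rewrite mulr_ge0.
  (* This makes the error at most [e]; the added 1 keeps [t] positive when the numerator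
     vanishes. *)
  pose t := (\sum_i w i * y i) / e + 1.
  have t0 : 0 < t by rewrite ltr_wpDl // divr_ge0 // ltW.
  apply: le_trans (F_mono _ (ltW t0)) (le_trans (F_ub _ t0) _).
  rewrite lerD2l ler_pdivrMr // /t mulrDr mulr1 mulrCA divff ?gt_eqF // mulr1 lerDl ltW //.
under eq_bigr do rewrite mulrBr; under [leRHS]eq_bigr do rewrite mulrBr.
by rewrite !sumrB; move: main; rewrite F0 => main; lra.
Qed.
End Calculus.

(** * Hermitian matrices and their entropy *)

Section Matrices.
Variable R : realType.
Local Notation C := R[i].
Local Notation Re := (@complex.Re R).
Local Notation "x %:C" := (real_complex R x).

(** The squared modulus as an element of [R], where [ln] and the probabilities live. *)
Definition sqn (z : C) : R := Re z ^+ 2 + complex.Im z ^+ 2.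

Lemma sqn_ge0 z : 0 <= sqn z.
Proof. by rewrite addr_ge0 ?sqr_ge0. Qed.

Lemma conjc_mul z : conjc z * z = (sqn z)%:C.
Proof.
case: z => a b; apply/eqP; rewrite eq_complex /sqn /=.
by apply/andP; split; apply/eqP; ring.
Qed.

Lemma mul_conjc z : z * conjc z = (sqn z)%:C.
Proof. by rewrite mulrC conjc_mul. Qed.

Lemma Re_realM (x : R) z : Re (x%:C * z) = x * Re z.
Proof. by case: z => a b; rewrite /= mul0r subr0. Qed.

Lemma Re_real (x : R) : Re x%:C = x. Proof. by []. Qed.

Lemma sqn_realM (x : R) z : sqn (x%:C * z) = x ^+ 2 * sqn z.
Proof. by case: z => a b; rewrite /sqn /=; ring. Qed.

Lemma sqn_conjc z : sqn (conjc z) = sqn z.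
Proof. by case: z => a b; rewrite /sqn /= sqrrN. Qed.

Lemma conjc_realM (x : R) z : conjc (x%:C * z) = x%:C * conjc z.
Proof. by rewrite rmorphM; congr (_ * _); exact: conjc_real. Qed.

Lemma adjE m n (A : 'M[C]_(m, n)) i j : adj A i j = conjc (A j i).
Proof. by rewrite !mxE. Qed.

Lemma adjM m n p (A : 'M[C]_(m, n)) (B : 'M[C]_(n, p)) : adj (A *m B) = adj B *m adj A.
Proof. by rewrite /adj map_mxM trmx_mul. Qed.

Lemma adjK m n (A : 'M[C]_(m, n)) : adj (adj A) = A.
Proof. by apply/matrixP => i j; rewrite !adjE conjcK. Qed.

Lemma adjD m n (A B : 'M[C]_(m, n)) : adj (A + B) = adj A + adj B.
Proof. by rewrite /adj map_mxD linearD. Qed.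

Lemma adjZ m n (x : R) (A : 'M[C]_(m, n)) : adj (x%:C *: A) = x%:C *: adj A.
Proof. by apply/matrixP => i j; rewrite !mxE conjc_realM. Qed.

Lemma adj0 m n : adj (0 : 'M[C]_(m, n)) = 0.
Proof. by rewrite /adj map_mx0 trmx0. Qed.

Lemma adj_diag_real n (x : 'I_n -> R) :
  adj (diag_mx (\row_k (x k)%:C)) = diag_mx (\row_k (x k)%:C).
Proof.
apply/matrixP => i j; rewrite !mxE eq_sym.
by case: eqVneq => [->|_]; rewrite ?mulr1n ?mulr0n; [exact: conjc_real | exact: conjc0].
Qed.

Lemma adj_mulE m n p (A : 'M[C]_(n, m)) (B : 'M[C]_(n, p)) a b :
  (adj A *m B) a b = \sum_k conjc (A k a) * B k b.
Proof. by rewrite mxE; apply: eq_bigr => k _; rewrite adjE. Qed.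

Lemma col_norm m n (A : 'M[C]_(m, n)) a : (adj A *m A) a a = (\sum_k sqn (A k a))%:C.
Proof. by rewrite adj_mulE rmorph_sum; apply: eq_bigr => k _; rewrite conjc_mul. Qed.

Lemma row_norm m n (A : 'M[C]_(m, n)) a : (A *m adj A) a a = (\sum_k sqn (A a k))%:C.
Proof. by rewrite mxE rmorph_sum; apply: eq_bigr => k _; rewrite adjE mul_conjc. Qed.

(** * Positive semidefinite matrices and their diagonalization *)

Definition psd n (A : 'M[C]_n) : Prop :=
  adj A = A /\ forall v : 'cV[C]_n, 0 <= (adj v *m A *m v) 0 0.

Definition expect n (A : 'M[C]_n) (v : 'cV[C]_n) : R := Re ((adj v *m A *m v) 0 0).

Lemma expect_ge0 n (A : 'M[C]_n) v : psd A -> 0 <= expect A v.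
Proof. by case=> _ /(_ v); rewrite lecE => /andP[]. Qed.

Lemma expect_sum (I : finType) n (p : I -> R) (A : I -> 'M[C]_n) v :
  expect (\sum_i (p i)%:C *: A i) v = \sum_i p i * expect (A i) v.
Proof.
rewrite /expect mulmx_sumr mulmx_suml summxE raddf_sum /=; apply: eq_bigr => i _.
by rewrite -scalemxAr -scalemxAl mxE Re_realM.
Qed.

Lemma expect_delta n (A : 'M[C]_n) k : expect A (delta_mx k 0) = Re (A k k).
Proof.
rewrite /expect -mulmxA -colE adj_mulE (bigD1 k) //= big1 ?addr0.
  by rewrite !mxE !eqxx conjc1 mul1r.
by move=> j jk; rewrite !mxE (negPf jk) conjc0 mul0r.
Qed.

Lemma psd_diag_ge0 n (A : 'M[C]_n) k : psd A -> 0 <= Re (A k k).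
Proof. by move=> psdA; rewrite -expect_delta expect_ge0. Qed.

Lemma psd_sum (I : finType) n (p : I -> R) (A : I -> 'M[C]_n) :
  (forall i, 0 <= p i) -> (forall i, psd (A i)) -> psd (\sum_i (p i)%:C *: A i).
Proof.
move=> p0 psdA; split.
  rewrite (big_morph (@adj R n n) (@adjD n n) (adj0 n n)).
  by apply: eq_bigr => i _; rewrite adjZ (psdA i).1.
move=> v; rewrite mulmx_sumr mulmx_suml summxE sumr_ge0 // => i _.
by rewrite -scalemxAr -scalemxAl mxE mulr_ge0 ?(psdA i).2 // lecE /= eqxx p0.
Qed.

Lemma psd_mul_adj m n (A : 'M[C]_(m, n)) : psd (A *m adj A).
Proof.
split=> [|v]; first by rewrite adjM adjK.
rewrite !mulmxA -[adj v *m A]adjK adjM adjK -mulmxA col_norm lecE /= eqxx /=.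
by rewrite sumr_ge0 // => k _; exact: sqn_ge0.
Qed.

Definition diagonalizes n (U : 'M[C]_n) (l : 'I_n -> R) (A : 'M[C]_n) : Prop :=
  [/\ adj U *m U = 1%:M, U *m adj U = 1%:M & A = U *m diag_mx (\row_a (l a)%:C) *m adj U].

Lemma expect_diagonalizes n (U : 'M[C]_n) l A v : diagonalizes U l A ->
  expect A v = \sum_a l a * sqn ((adj U *m v) a 0).
Proof.
case=> _ _ ->; rewrite /expect.
have -> : adj v *m (U *m diag_mx (\row_a (l a)%:C) *m adj U) *m v =
    adj (adj U *m v) *m (diag_mx (\row_a (l a)%:C) *m (adj U *m v)).
  by rewrite adjM adjK !mulmxA.
rewrite adj_mulE raddf_sum /=; apply: eq_bigr => a _.
by rewrite mul_diag_mx !mxE mulrCA Re_realM conjc_mul.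
Qed.

Lemma diag_diagonalizes n (U : 'M[C]_n) l A k : diagonalizes U l A ->
  Re (A k k) = \sum_a l a * sqn (U k a).
Proof.
move=> dA; rewrite -expect_delta (expect_diagonalizes _ dA); apply: eq_bigr => a _.
by rewrite -colE mxE adjE sqn_conjc.
Qed.

Lemma expect_eigen n (U : 'M[C]_n) l A a : diagonalizes U l A -> expect A (col a U) = l a.
Proof.
move=> dA; rewrite (expect_diagonalizes _ dA); case: dA => UU _ _.
rewrite colE mulmxA UU mul1mx (bigD1 a) //= big1 ?addr0 => [|b ba]; rewrite !mxE.
  by rewrite !eqxx /sqn /= expr1n expr0n addr0 mulr1.
by rewrite (negPf ba) /sqn /= expr0n addr0 mulr0.
Qed.

(** The spectral theorem for normal matrices. There the eigenvectors are the rows of [P], hence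
    [U = adj P]; each eigenvalue is the quadratic form at its eigenvector, so it is real and
    nonnegative. *)
Lemma psd_diagonalizes n (A : 'M[C]_n) : psd A ->
  exists U l, (forall a, 0 <= l a) /\ diagonalizes U l A.
Proof.
move=> psdA; have [hA _] := psdA.
have nA : A \is normalmx.
  by apply/normalmxP; have -> : map_mx Num.conj A^T = A by rewrite -[RHS]hA /adj map_trmx.
have := spectral_unitarymx A; have /orthomx_spectralP := nA.
set P := spectralmx A; set d := spectral_diag A => Adec Pu.
have PE : map_mx Num.conj P^T = adj P by rewrite /adj map_trmx.
have PP : P *m adj P = 1%:M by rewrite -PE; apply/unitarymxP.
have PP' : adj P *m P = 1%:M by apply: mulmx1C.
rewrite invmx_unitary // PE in Adec.
have dE a : d 0 a = (adj (col a (adj P)) *m A *m col a (adj P)) 0 0.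
  rewrite !colE adjM adjK Adec !mulmxA -(mulmxA _ P) PP mulmx1 -(mulmxA _ P) PP mulmx1.
  rewrite -!mulmxA -colE adj_mulE (bigD1 a) //= big1 ?addr0.
    by rewrite !mxE !eqxx conjc1 mul1r mulr1n.
  by move=> b ba; rewrite !mxE (negPf ba) conjc0 mul0r.
exists (adj P), (fun a => Re (d 0 a)); split.
  by move=> a; rewrite dE; exact: expect_ge0.
split; rewrite ?adjK; [exact: PP | exact: PP' | rewrite {1}Adec].
congr (_ *m diag_mx _ *m _); apply/rowP => a; rewrite mxE dE; have := psdA.2 (col a (adj P)).
by rewrite lecE => /andP[/eqP]; case: (_ 0 0) => x y /= -> _.
Qed.

(** * Entropy through the characteristic polynomial *)

Lemma eigvalsP n (A : 'M[C]_n) : char_poly A = \prod_(z <- eigvals A) ('X - z%:P).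
Proof.
rewrite /eigvals; case: closed_field_poly_normal => s /= ->.
by rewrite (monicP (char_poly_monic A)) scale1r.
Qed.

(** Two factorizations into linear factors agree up to permutation, so the entropy can be read off
    any of them. *)
Lemma vn_entropy_char_poly n (A : 'M[C]_n) (s : seq C) :
  char_poly A = \prod_(z <- s) ('X - z%:P) ->
  vn_entropy A = - \sum_(z <- s) Re z * ln (Re z).
Proof.
by rewrite eigvalsP => /prod_XsubC_eq sE; rewrite /vn_entropy (perm_big _ sE).
Qed.

Lemma vn_entropy_diag n (d : 'rV[C]_n) :
  vn_entropy (diag_mx d) = - \sum_k Re (d 0 k) * ln (Re (d 0 k)).
Proof.
rewrite (@vn_entropy_char_poly _ _ [seq d 0 k | k <- index_enum 'I_n]) ?big_map //.
rewrite char_poly_trig; last exact: diag_mx_is_trig.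
by apply: eq_bigr => k _; rewrite mxE eqxx mulr1n.
Qed.

Lemma vn_entropy_dephase n (A : 'M[C]_n) :
  vn_entropy (dephase A) = - \sum_k Re (A k k) * ln (Re (A k k)).
Proof.
by rewrite vn_entropy_diag; congr (- _); apply: eq_bigr => k _; rewrite !mxE.
Qed.

Lemma char_poly_conjugate n (U V D : 'M[C]_n) : U *m V = 1%:M ->
  char_poly (U *m D *m V) = char_poly D.
Proof.
move=> UV; rewrite /char_poly.
have -> : char_poly_mx (U *m D *m V) = map_mx polyC U *m char_poly_mx D *m map_mx polyC V.
  rewrite /char_poly_mx mulmxBr mulmxBl !map_mxM; congr (_ - _).
  by rewrite mul_mx_scalar -scalemxAl -map_mxM UV map_mx1 scalemx1.
rewrite !det_mulmx mulrAC -det_mulmx -map_mxM UV map_mx1 det1 mul1r //.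
Qed.

Lemma vn_entropy_diagonalizes n (U : 'M[C]_n) l A : diagonalizes U l A ->
  vn_entropy A = - \sum_a l a * ln (l a).
Proof.
case=> _ UU ->; rewrite (@vn_entropy_char_poly _ _ [seq (l a)%:C | a <- index_enum 'I_n]).
  by rewrite big_map.
rewrite char_poly_conjugate // char_poly_trig; last exact: diag_mx_is_trig.
by rewrite big_map; apply: eq_bigr => k _; rewrite !mxE eqxx mulr1n.
Qed.

(** Two block eliminations compute the determinant of the matrix with block rows [X, A] and [B, 1];
    one produces [A *m B], the other [B *m A]. *)
Lemma char_poly_mulC m n (A : 'M[C]_(m, n)) (B : 'M[C]_(n, m)) :
  'X^n * char_poly (A *m B) = 'X^m * char_poly (B *m A).
Proof.
pose a := map_mx polyC A; pose b := map_mx polyC B.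
have e1 : block_mx 1%:M (- a) 0 1%:M *m block_mx 'X%:M a b 1%:M
   = block_mx (char_poly_mx (A *m B)) 0 b 1%:M.
  rewrite mulmx_block !mul1mx !mul0mx !add0r !mulNmx mulmx1 subrr.
  by rewrite /char_poly_mx map_mxM.
have e2 : block_mx 1%:M 0 (- b) 'X%:M *m block_mx 'X%:M a b 1%:M
   = block_mx 'X%:M a 0 (char_poly_mx (B *m A)).
  rewrite mulmx_block !mul1mx !mul0mx !addr0 mulNmx mul_mx_scalar mul_scalar_mx addNr.
  by rewrite mulNmx mulmx1 /char_poly_mx map_mxM addrC.
have := congr1 determinant e1; have := congr1 determinant e2.
rewrite (det_mulmx (block_mx 1%:M 0 _ _)) (det_mulmx (block_mx 1%:M (- a) _ _)).
rewrite (det_lblock 1%:M) (det_ublock 1%:M) (det_ublock 'X%:M) det_lblock.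
rewrite !det1 (det_scalar n) (det_scalar m) !mul1r mulr1.
by move=> E1 E2; rewrite /char_poly -E2 E1.
Qed.

(* The two spectra differ only in zeros, and 0 ln 0 = 0. *)
Lemma vn_entropy_mulC m n (A : 'M[C]_(m, n)) (B : 'M[C]_(n, m)) :
  vn_entropy (A *m B) = vn_entropy (B *m A).
Proof.
have X0 k : 'X^k = \prod_(z <- nseq k (0 : C)) ('X - z%:P).
  by rewrite big_nseq polyC0 subr0 iter_mulr_1.
have := char_poly_mulC A B; rewrite !eigvalsP !X0 -!big_cat => /prod_XsubC_eq AB.
pose S (s : seq C) := \sum_(z <- s) Re z * ln (Re z).
have S0 k s : S (nseq k 0 ++ s) = S s.
  by rewrite /S big_cat big_nseq /= mul0r iter_addr_0 mul0rn add0r.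
rewrite /vn_entropy -/(S _) -/(S (eigvals (B *m A))).
by rewrite -(S0 n) -(S0 m (eigvals (B *m A))) /S (perm_big _ AB).
Qed.

Lemma vn_entropy_tr n (A : 'M[C]_n) : vn_entropy A^T = vn_entropy A.
Proof.
apply: vn_entropy_char_poly; rewrite -eigvalsP /char_poly -det_tr; congr (\det _).
by rewrite /char_poly_mx linearB /= tr_scalar_mx map_trmx trmxK.
Qed.

(** Completing the square: for [d > 0] the difference of the two sides, times [d], is the squared
    modulus of [l u - d c]. For [d = 0] both sides are 0. *)
Lemma amgm_complex (l d : R) (u c : C) : 0 <= d -> (d = 0 -> l = 0) ->
  2 * (l * Re (conjc u * c)) - d * sqn c <= sqn u * l ^+ 2 / d.
Proof.
move=> d0 dl; have [d00|dn0] := eqVneq d 0.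
  by rewrite d00 (dl d00) invr0 !mul0r !mulr0 subr0.
have dp : 0 < d by rewrite lt_neqAle eq_sym dn0.
rewrite ler_pdivlMr // -subr_ge0.
case: u c => u1 u2 [c1 c2]; rewrite /sqn /=.
suff -> : (u1 ^+ 2 + u2 ^+ 2) * l ^+ 2
    - (2 * (l * (u1 * c1 - - u2 * c2)) - d * (c1 ^+ 2 + c2 ^+ 2)) * d =
  (l * u1 - d * c1) ^+ 2 + (l * u2 - d * c2) ^+ 2 by rewrite addr_ge0 ?sqr_ge0.
by ring.
Qed.

(** * Pinching and convexity of the relative entropy of coherence *)

(* The resolvent quantity on the right is the supremum over matrices X of
   2 Re tr(X^* A) - tr(X^* B X) - t tr(X A X^* ); the left is the value at the
   best diagonal X. *)
Lemma pinching_resolvent n (A B U V : 'M[C]_n) (l m : 'I_n -> R) (t : R) :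
  diagonalizes U l A -> diagonalizes V m B ->
  (forall a, 0 <= l a) -> (forall b, 0 <= m b) -> 0 < t ->
  \sum_k Re (A k k) ^+ 2 / (Re (B k k) + t * Re (A k k)) <=
  \sum_a \sum_b sqn ((adj V *m U) b a) * l a ^+ 2 / (m b + t * l a).
Proof.
move=> dA dB l0 m0 t0; set p := fun k => Re (A k k); set q := fun k => Re (B k k).
have pE k : p k = \sum_a l a * sqn (U k a) by exact: diag_diagonalizes.
have qE k : q k = \sum_b m b * sqn (V k b) by exact: diag_diagonalizes.
have p0 k : 0 <= p k by rewrite pE sumr_ge0 // => a _; rewrite mulr_ge0 ?sqn_ge0.
have q0 k : 0 <= q k by rewrite qE sumr_ge0 // => a _; rewrite mulr_ge0 ?sqn_ge0.
(* The maximizer of [2 x p - x^2 q - t x^2 p]; a zero denominator forces [p k = q k = 0] and gives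
   [x k = 0]. *)
pose x k := p k / (q k + t * p k).
pose X : 'M[C]_n := diag_mx (\row_k (x k)%:C).
have hX : adj X = X by exact: adj_diag_real.
(* The identity and [X] written in the eigenbases of [B] (rows) and [A] (columns), where the
   variational expression decouples into entries. *)
pose c := adj V *m X *m U; pose u := adj V *m U.
have [UU UU' _] := dA; have [VV VV' _] := dB.
have XU k a : (X *m U) k a = (x k)%:C * U k a by rewrite mul_diag_mx !mxE.
have c_col a : \sum_b sqn (c b a) = \sum_k x k ^+ 2 * sqn (U k a).
  apply: (can_inj (fun r => Re_real r)); rewrite -col_norm /c -mulmxA adjM adjK.
  rewrite !mulmxA -(mulmxA _ V) VV' mulmx1 -mulmxA col_norm; congr (_ %:C).
  by apply: eq_bigr => k _; rewrite XU sqn_realM.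
have c_row b : \sum_a sqn (c b a) = \sum_k x k ^+ 2 * sqn (V k b).
  apply: (can_inj (fun r => Re_real r)); rewrite -row_norm /c adjM.
  rewrite !mulmxA -(mulmxA _ U) UU' mulmx1 row_norm; congr (_ %:C).
  apply: eq_bigr => k _; rewrite -[_ *m X]adjK adjE sqn_conjc adjM adjK hX.
  by rewrite mul_diag_mx !mxE sqn_realM.
have uc a : \sum_b Re (conjc (u b a) * c b a) = \sum_k x k * sqn (U k a).
  rewrite -raddf_sum /= -adj_mulE /u /c adjM adjK !mulmxA -(mulmxA _ V) VV' mulmx1.
  rewrite -mulmxA adj_mulE raddf_sum /=; apply: eq_bigr => k _.
  by rewrite XU mulrCA Re_realM conjc_mul.
have step k : p k ^+ 2 / (q k + t * p k) = 2 * (x k * p k) - x k ^+ 2 * q k - t * (x k ^+ 2 * p k).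
  have [d0|dn0] := eqVneq (q k + t * p k) 0; last by rewrite /x; field.
  by rewrite /x d0 invr0 !mulr0 expr0n /= !mul0r !mulr0 !subr0.
have pU (y : 'I_n -> R) : \sum_k y k * p k = \sum_a l a * \sum_k y k * sqn (U k a).
  under eq_bigr do rewrite pE mulr_sumr; rewrite exchange_big; apply: eq_bigr => a _.
  by rewrite mulr_sumr; apply: eq_bigr => k _; rewrite mulrCA.
have qV (y : 'I_n -> R) : \sum_k y k * q k = \sum_b m b * \sum_k y k * sqn (V k b).
  under eq_bigr do rewrite qE mulr_sumr; rewrite exchange_big; apply: eq_bigr => a _.
  by rewrite mulr_sumr; apply: eq_bigr => k _; rewrite mulrCA.
under eq_bigr do rewrite step; rewrite !sumrB -!mulr_sumr pU qV pU.
under eq_bigr do rewrite -uc; under [X in _ - X - _]eq_bigr do rewrite -c_row.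
under [X in _ - _ - _ * X]eq_bigr do rewrite -c_col.
apply: (@le_trans _ _ (\sum_a \sum_b
    (2 * (l a * Re (conjc (u b a) * c b a)) - (m b + t * l a) * sqn (c b a)))).
  rewrite le_eqVlt; apply/orP; left; apply/eqP.
  under [X in _ - X - _]eq_bigr do rewrite mulr_sumr.
  rewrite [X in _ - X - _]exchange_big !mulr_sumr -!sumrB; apply: eq_bigr => a _.
  by rewrite !mulr_sumr -!sumrB; apply: eq_bigr => b _; ring.
(* The diagonal constraint on [X] is dropped here: each entry [c b a] is compared with its own
   optimum. *)
apply: ler_sum => a _; apply: ler_sum => b _; apply: amgm_complex.
  by rewrite addr_ge0 // mulr_ge0 // ltW.
move=> /eqP; rewrite paddr_eq0 ?mulr_ge0 ?(ltW t0) // mulf_eq0 (gt_eqF t0) /=.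
by case/andP=> _ /eqP.
Qed.

(* This is D(diag A || diag B) <= D(A || B); the domination hypothesis supplies the
   inclusion of supports that keeps the junk value ln 0 = 0 harmless. *)
Lemma pinching n (A B V : 'M[C]_n) (m : 'I_n -> R) (r : R) :
  psd A -> diagonalizes V m B -> (forall b, 0 <= m b) -> 0 < r ->
  (forall v, r * expect A v <= expect B v) ->
  \sum_k Re (A k k) * ln (Re (A k k)) - \sum_k Re (A k k) * ln (Re (B k k))
  <= - vn_entropy A - \sum_b ln (m b) * expect A (col b V).
Proof.
move=> psdA dB m0 r0 AB; have [U [l [l0 dA]]] := psd_diagonalizes psdA.
have [UU UU' _] := dA; have [VV VV' _] := dB.
pose w b a := sqn ((adj V *m U) b a).
have w_expect b : expect A (col b V) = \sum_a w b a * l a.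
  rewrite (expect_diagonalizes _ dA); apply: eq_bigr => a _; rewrite mulrC /w.
  by congr (_ * _); rewrite colE mulmxA -colE mxE -[adj U *m V]adjK adjE sqn_conjc adjM adjK.
have w1 a : \sum_b w b a = 1.
  apply: (can_inj (fun r => Re_real r)); rewrite -col_norm adjM adjK.
  by rewrite !mulmxA -(mulmxA _ V) VV' mulmx1 UU mxE eqxx.
(* Null vectors of [B] are null for [A]; both support hypotheses come from this. *)
have null v : expect B v = 0 -> expect A v = 0.
  move=> Bv; apply/eqP; rewrite eq_le expect_ge0 // andbT.
  by have := AB v; rewrite Bv pmulr_rle0.
(* The pairs carry the Nussbaum-Szkola weights [w b a * l a] and [w b a * m b], whose classical
   relative entropy is D(A || B). *)
have main := @log_sum_of_resolvent R ('I_n * 'I_n)%type 'I_n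
  (fun ij => w ij.2 ij.1) (fun ij => l ij.1) (fun ij => m ij.2)
  (fun k => Re (A k k)) (fun k => Re (B k k)).
have {main} : \sum_k Re (A k k) * (ln (Re (A k k)) - ln (Re (B k k))) <=
    \sum_(ij : 'I_n * 'I_n) w ij.2 ij.1 * l ij.1 * (ln (l ij.1) - ln (m ij.2)).
  apply: main.
  - by move=> ij; exact: sqn_ge0.
  - by [].
  - by [].
  - by move=> k; exact: psd_diag_ge0.
  - move=> k; rewrite (diag_diagonalizes _ dB) sumr_ge0 // => b _.
    by rewrite mulr_ge0 ?sqn_ge0.
  - move=> [a b] /= mb; have : expect A (col b V) = 0 by apply: null; rewrite (expect_eigen _ dB).
    by rewrite w_expect => /psumr_eq0P -> // c _; rewrite mulr_ge0 ?sqn_ge0.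
  - by move=> k; rewrite -!expect_delta; exact: null.
  - rewrite -(pair_bigA _ (fun a b => w b a * l a)) /=.
    under eq_bigr do rewrite -mulr_suml w1 mul1r.
    under [RHS]eq_bigr do rewrite (diag_diagonalizes _ dA).
    rewrite exchange_big; apply: eq_bigr => a _; rewrite -mulr_sumr.
    suff -> : \sum_k sqn (U k a) = 1 by rewrite mulr1.
    by apply: (can_inj (fun r => Re_real r)); rewrite -col_norm UU mxE eqxx.
  - move=> t t0; rewrite -(pair_bigA _ (fun a b => w b a * l a ^+ 2 / (m b + t * l a))) /=.
    exact: pinching_resolvent.
under eq_bigr do rewrite mulrBr; rewrite sumrB => /le_trans; apply.
rewrite -(pair_bigA _ (fun a b => w b a * l a * (ln (l a) - ln (m b)))) /=.
rewrite (vn_entropy_diagonalizes dA) opprK le_eqVlt; apply/orP; left; apply/eqP.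
under eq_bigr do under eq_bigr do rewrite mulrBr.
under eq_bigr do rewrite sumrB; rewrite sumrB; congr (_ - _).
  by apply: eq_bigr => a _; rewrite -!mulr_suml w1 mul1r.
rewrite exchange_big; apply: eq_bigr => b _.
by rewrite w_expect mulr_sumr; apply: eq_bigr => a _; rewrite mulrC.
Qed.

(** For [p i > 0] the matrix [B] dominates [p i] times [A i], so [pinching] applies with [r = p i].
    The cross terms are linear in [A i], so they average to minus the entropies of [dephase B] and
    [B]. *)
Lemma coh_rel_convex (I : finType) n (p : I -> R) (A : I -> 'M[C]_n) :
  (forall i, 0 <= p i) -> (forall i, psd (A i)) ->
  coh_rel (\sum_i (p i)%:C *: A i) <= \sum_i p i * coh_rel (A i).
Proof.
move=> p0 psdA; set B := \sum_i _; have psdB : psd B by exact: psd_sum.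
have [V [m [m0 dB]]] := psd_diagonalizes psdB.
have pin i : p i * (\sum_k Re (A i k k) * ln (Re (A i k k)) - \sum_k Re (A i k k) * ln (Re (B k k)))
  <= p i * (- vn_entropy (A i) - \sum_b ln (m b) * expect (A i) (col b V)).
  have [->|pi0] := eqVneq (p i) 0; first by rewrite !mul0r.
  have pip : 0 < p i by rewrite lt_neqAle eq_sym pi0 p0.
  rewrite ler_wpM2l //; apply: pinching dB m0 pip _ => // v.
  rewrite expect_sum (bigD1 i) //= lerDl sumr_ge0 // => j _.
  by rewrite mulr_ge0 // expect_ge0.
have E1 : \sum_i p i * \sum_k Re (A i k k) * ln (Re (B k k)) = - vn_entropy (dephase B).
  rewrite vn_entropy_dephase opprK; under eq_bigr do rewrite mulr_sumr.
  rewrite exchange_big; apply: eq_bigr => k _ /=.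
  rewrite -[X in _ = X * _]expect_delta expect_sum mulr_suml; apply: eq_bigr => i _.
  by rewrite expect_delta mulrA.
have E2 : \sum_i p i * \sum_b ln (m b) * expect (A i) (col b V) = - vn_entropy B.
  rewrite (vn_entropy_diagonalizes dB) opprK; under eq_bigr do rewrite mulr_sumr.
  rewrite exchange_big; apply: eq_bigr => b _ /=.
  rewrite -[X in _ = X * _](expect_eigen _ dB) expect_sum mulr_suml; apply: eq_bigr => i _.
  by rewrite mulrA mulrAC.
have E3 i : \sum_k Re (A i k k) * ln (Re (A i k k)) = - vn_entropy (dephase (A i)).
  by rewrite vn_entropy_dephase opprK.
(* The final rearrangement, with [h], [s] for the entropies of [dephase (A i)] and [A i], and [x],
   [y] for the cross terms. *)
have combine (h s x y : I -> R) (hB sB : R) :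
    \sum_i p i * x i = - hB -> \sum_i p i * y i = - sB ->
    (forall i, p i * (- h i - x i) <= p i * (- s i - y i)) ->
    hB - sB <= \sum_i p i * (h i - s i).
  move=> xE yE le; have -> : hB - sB = \sum_i (p i * y i - p i * x i).
    by rewrite sumrB xE yE opprK addrC.
  by apply: ler_sum => i _; have := le i; lra.
by apply: combine E1 E2 _ => i; rewrite -E3; exact: pin.
Qed.

(** * Convex roofs *)

Lemma entropy_term_ge0 (x : R) : 0 <= x <= 1 -> 0 <= - (x * ln x).
Proof. by move=> /andP[x0 x1]; rewrite oppr_ge0 mulr_ge0_le0 // ln_le0. Qed.

Lemma sum_entropy_ge0 (I : finType) (x : I -> R) :
  (forall i, 0 <= x i) -> \sum_i x i = 1 -> 0 <= - \sum_i x i * ln (x i).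
Proof.
move=> x0 x1; rewrite -sumrN sumr_ge0 // => i _; rewrite entropy_term_ge0 // x0 /=.
by rewrite -x1 (bigD1 i) //= lerDl sumr_ge0.
Qed.

Lemma trace_diagonalizes n (U : 'M[C]_n) l A : diagonalizes U l A -> \tr A = (\sum_a l a)%:C.
Proof.
case=> UU _ ->; rewrite -mulmxA mxtrace_mulC -mulmxA UU mulmx1 rmorph_sum mxtrace_diag.
by apply: eq_bigr => a _; rewrite mxE.
Qed.

Lemma vn_entropy_ge0 n (A : 'M[C]_n) : psd A -> \tr A = 1 -> 0 <= vn_entropy A.
Proof.
move=> /psd_diagonalizes[U [l [l0 dA]]] tA; rewrite (vn_entropy_diagonalizes dA).
by apply: sum_entropy_ge0 => //; have := trace_diagonalizes dA; rewrite tA => -[].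
Qed.

Lemma projE n (v : 'cV[C]_n) i j : proj v i j = v i 0 * conjc (v j 0).
Proof. by rewrite /proj mxE big_ord1 adjE. Qed.

Lemma unit_vectorP n (v : 'cV[C]_n) : adj v *m v = 1%:M <-> \sum_k sqn (v k 0) = 1.
Proof.
split=> [vv|v1]; last by apply/matrixP => i j; rewrite !ord1 col_norm v1 mxE eqxx.
by apply: (can_inj (fun r => Re_real r)); rewrite -col_norm vv mxE eqxx.
Qed.

Lemma vn_entropy_dephase_proj n (v : 'cV[C]_n) :
  vn_entropy (dephase (proj v)) = - \sum_k sqn (v k 0) * ln (sqn (v k 0)).
Proof.
by rewrite vn_entropy_dephase; congr (- _); apply: eq_bigr => k _; rewrite projE mul_conjc.
Qed.

Lemma vn_entropy_dephase_proj_ge0 n (v : 'cV[C]_n) : adj v *m v = 1%:M ->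
  0 <= vn_entropy (dephase (proj v)).
Proof.
move=> /unit_vectorP v1; rewrite vn_entropy_dephase_proj sum_entropy_ge0 // => k.
exact: sqn_ge0.
Qed.

(** The spectral decomposition is a witness. It makes the set under [roof] nonempty, so that its
    [inf] is not a default value. *)
Lemma pure_decomp_exists n (rho : 'M[C]_n) : is_state rho ->
  exists k (p : 'I_k -> R) psi, pure_decomp rho p psi.
Proof.
case=> hrho pos tr1; have [U [l [l0 dA]]] := psd_diagonalizes (conj hrho pos).
exists n, l, (fun a => col a U); have [UU _ rhoE] := dA; split => //.
- by have := trace_diagonalizes dA; rewrite tr1 => -[].
- move=> a; apply/matrixP => i j; rewrite !ord1 adj_mulE [RHS]mxE eqxx.
  transitivity ((adj U *m U) a a); last by rewrite UU mxE eqxx.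
  by rewrite adj_mulE; apply: eq_bigr => k _; rewrite !mxE.
- rewrite {1}rhoE; apply/matrixP => i j; rewrite summxE mxE; apply: eq_bigr => a _.
  by rewrite mul_mx_diag [RHS]mxE projE !mxE mulrCA mulrA.
Qed.

(** Nonnegativity of [f] on unit vectors bounds the set below, so its [inf] lies below each element.
    Any finite index type is allowed, and normalization is asked only at nonzero weight, as steering
    produces null vectors. *)
Lemma roof_le (I : finType) n (f : 'cV[C]_n -> R) (rho : 'M[C]_n) (p : I -> R) psi :
  (forall v, adj v *m v = 1%:M -> 0 <= f v) ->
  (forall i, 0 <= p i) -> \sum_i p i = 1 ->
  (forall i, p i != 0 -> adj (psi i) *m psi i = 1%:M) ->
  rho = \sum_i (p i)%:C *: proj (psi i) ->
  roof f rho <= \sum_i p i * f (psi i).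
Proof.
move=> f0 p0 p1 psi1 rhoE.
have [i0 pi0] : exists i, p i != 0.
  apply/existsP; rewrite -[X in is_true X]negbK negb_exists; apply/negP => /forallP p00.
  move/eqP: p1; rewrite big1 ?(eq_sym 0) ?oner_eq0 // => i _.
  by apply/eqP; have := p00 i; rewrite negbK.
(* A fixed unit vector replaces those of weight zero without changing either sum. *)
pose psi' i := if p i == 0 then psi i0 else psi i.
have psi'1 i : adj (psi' i) *m psi' i = 1%:M.
  by rewrite /psi'; case: eqVneq => [_|pi]; apply: psi1.
have enum_sum (V : nmodType) (F : I -> V) : \sum_i F i = \sum_(j < #|I|) F (enum_val j).
  by rewrite (reindex (@enum_val I I)) //; apply/onW_bij/enum_val_bij.
apply: ge_inf.
  exists 0 => x [k [q [phi [[q0 _ phi1 _] ->]]]].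
  by apply: sumr_ge0 => i _; rewrite mulr_ge0 // f0.
exists #|I|, (fun j => p (enum_val j)), (fun j => psi' (enum_val j)); split.
  split => //; first by rewrite -enum_sum.
  rewrite -(enum_sum _ (fun i => (p i)%:C *: proj (psi' i))) rhoE; apply: eq_bigr => i _.
  by rewrite /psi'; case: eqVneq => [->|_]; [rewrite !scale0r|].
rewrite -(enum_sum _ (fun i => p i * f (psi' i))); apply: eq_bigr => i _.
by rewrite /psi'; case: eqVneq => [->|_]; [rewrite !mul0r|].
Qed.

Lemma le_roof n (f : 'cV[C]_n -> R) (rho : 'M[C]_n) (x : R) : is_state rho ->
  (forall k (p : 'I_k -> R) psi, pure_decomp rho p psi -> x <= \sum_i p i * f (psi i)) ->
  x <= roof f rho.
Proof.
move=> /pure_decomp_exists[k [p [psi dec]]] lb; apply: lb_le_inf.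
  by exists (\sum_i p i * f (psi i)), k, p, psi.
by move=> _ [k' [p' [psi' [dec' ->]]]]; exact: lb.
Qed.

(* Conditioning on the first index j steers the second party into the
   normalized j-th row of M, with probability the squared norm of that row. *)
Lemma coh_form_le_cond_entropy (I : finType) m n (p : I -> R) (M : I -> 'M[C]_(m, n)) :
  (forall i, 0 <= p i) -> \sum_i p i = 1 ->
  (forall i, \sum_j \sum_k sqn (M i j k) = 1) ->
  coh_form (\sum_i (p i)%:C *: ((M i)^T *m adj (M i)^T)) <=
  \sum_i p i * (\sum_j (\sum_k sqn (M i j k)) * ln (\sum_k sqn (M i j k))
                - \sum_j \sum_k sqn (M i j k) * ln (sqn (M i j k))).
Proof.
move=> p0 p1 M1; pose r i j := \sum_k sqn (M i j k).
have r0 i j : 0 <= r i j by apply: sumr_ge0 => k _; exact: sqn_ge0.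
have r_null i j k : r i j = 0 -> M i j k = 0.
  move=> /psumr_eq0P-/(_ (fun k _ => sqn_ge0 (M i j k)))/(_ k isT)/eqP.
  rewrite /sqn paddr_eq0 ?sqr_ge0 // !sqrf_eq0; case: (M i j k) => a b /=.
  by move=> /andP[/eqP-> /eqP->].
(* For a null row the inverse is 0 and so is the vector; its weight is then 0. *)
pose psi (ij : I * 'I_m) : 'cV[C]_n := \col_k ((Num.sqrt (r ij.1 ij.2))^-1%:C * M ij.1 ij.2 k).
have sqn_psi i j k : sqn (psi (i, j) k 0) = (r i j)^-1 * sqn (M i j k).
  by rewrite mxE sqn_realM /= exprVn sqr_sqrtr.
apply: (le_trans (@roof_le (I * 'I_m)%type _ _ _ (fun ij => p ij.1 * r ij.1 ij.2) psi _ _ _ _ _)).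
- exact: vn_entropy_dephase_proj_ge0.
- by move=> [i j]; rewrite mulr_ge0.
- rewrite -(pair_bigA _ (fun i j => p i * r i j)) /= -[RHS]p1; apply: eq_bigr => i _.
  by rewrite -mulr_sumr M1 mulr1.
- move=> [i j] /=; rewrite mulf_eq0 negb_or => /andP[_ rn0]; apply/unit_vectorP.
  by under eq_bigr do rewrite sqn_psi; rewrite -mulr_sumr mulVf.
- rewrite -(pair_bigA _ (fun i j => (p i * r i j)%:C *: proj (psi (i, j)))) /=.
  apply: eq_bigr => i _; apply/matrixP => a b; rewrite mxE summxE mxE mulr_sumr.
  apply: eq_bigr => j _; rewrite [RHS]mxE projE adjE !mxE.
  have [rij|rn0] := eqVneq (r i j) 0; first by rewrite !r_null // !(mul0r, mulr0).
  have rs : (r i j)%:C * ((Num.sqrt (r i j))^-1%:C * (Num.sqrt (r i j))^-1%:C) = 1.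
    by rewrite -!rmorphM /= -expr2 exprVn sqr_sqrtr // divff.
  rewrite conjc_realM rmorphM -[LHS]mul1r -{1}rs.
  by ring.
rewrite -(pair_bigA _ (fun i j => p i * r i j * vn_entropy (dephase (proj (psi (i, j)))))) /=.
(* The chain rule row by row: with [s] the squared entries of a row and [r] their sum, [r] times the
   entropy of [s / r] is [r ln r] minus the sum of [s ln s]. *)
apply: ler_sum => i _; rewrite -sumrB mulr_sumr; apply: ler_sum => j _.
rewrite -mulrA ler_wpM2l // vn_entropy_dephase_proj -/(r i j).
have [rij|rn0] := eqVneq (r i j) 0.
  by rewrite rij !mul0r big1 ?subr0 // => k _; rewrite r_null // /sqn /= expr0n addr0 mul0r.
have rp : 0 < r i j by rewrite lt_neqAle eq_sym rn0 r0.
rewrite mulrN mulr_sumr {2}/r mulr_suml -sumrB -sumrN; apply: ler_sum => k _.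
rewrite sqn_psi; have [->|sn0] := eqVneq (sqn (M i j k)) 0.
  by rewrite !(mulr0, mul0r) subr0 oppr0.
have sp : 0 < sqn (M i j k) by rewrite lt_neqAle eq_sym sn0 sqn_ge0.
rewrite lnM ?posrE ?invr_gt0 // lnV ?posrE // !mulrA divff // mul1r.
by rewrite mulrDr mulrN; lra.
Qed.

(** The three terms on the left are at most the averages of [H(J) - S], [H(K|J)] and [S], which add
    up to the joint entropy [H(JK)]. Transposing [M] gives the same bound with the two systems
    exchanged. *)
Lemma coherence_splitting (I : finType) m n (p : I -> R) (M : I -> 'M[C]_(m, n)) :
  (forall i, 0 <= p i) -> \sum_i p i = 1 ->
  (forall i, \sum_j \sum_k sqn (M i j k) = 1) ->
  coh_rel (\sum_i (p i)%:C *: (M i *m adj (M i)))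
  + coh_form (\sum_i (p i)%:C *: ((M i)^T *m adj (M i)^T))
  + \sum_i p i * vn_entropy (M i *m adj (M i))
  <= \sum_i p i * - \sum_j \sum_k sqn (M i j k) * ln (sqn (M i j k)).
Proof.
move=> p0 p1 M1.
have conv := coh_rel_convex p0 (fun i => psd_mul_adj (M i)).
have cond := coh_form_le_cond_entropy p0 p1 M1.
apply: (le_trans (lerD (lerD conv cond) (lexx _))).
rewrite -!big_split /= le_eqVlt; apply/orP; left; apply/eqP; apply: eq_bigr => i _.
have Re_row_norm j : Re ((M i *m adj (M i)) j j) = \sum_k sqn (M i j k) by rewrite row_norm.
rewrite -!mulrDr /coh_rel vn_entropy_dephase; congr (_ * _).
rewrite (eq_bigr _ (fun j _ => congr2 (fun x y => x * ln y) (Re_row_norm j) (Re_row_norm j))).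
by ring.
Qed.

End Matrices.

(** * Bipartite systems *)

Section Bipartite.
Variables (R : realType) (m n : nat).
Local Notation C := R[i].
Local Notation "x %:C" := (real_complex R x).

(** Reshaping a vector into a matrix turns its reduced states into Gram matrices of the rows and of
    the columns. *)
Definition coeff_mx (v : 'cV[C]_(m * n)) : 'M[C]_(m, n) :=
  \matrix_(i, j) v (mxvec_index i j) 0.

Lemma sum_mxvec_index (V : nmodType) (F : 'I_(m * n) -> V) :
  \sum_k F k = \sum_i \sum_j F (mxvec_index i j).
Proof.
rewrite pair_bigA (reindex _ (curry_mxvec_bij _ _)) /=.
by apply: eq_bigr => -[i j].
Qed.

Lemma ptraceB_proj v : ptraceB m n (proj v) = coeff_mx v *m adj (coeff_mx v).
Proof.
apply/matrixP => i i'; rewrite !mxE; apply: eq_bigr => j _.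
by rewrite projE adjE !mxE.
Qed.

Lemma ptraceA_proj v : ptraceA m n (proj v) = (coeff_mx v)^T *m adj (coeff_mx v)^T.
Proof.
apply/matrixP => i i'; rewrite !mxE; apply: eq_bigr => j _.
by rewrite projE adjE !mxE.
Qed.

Lemma ptraceB_sum k (p : 'I_k -> R) (A : 'I_k -> 'M[C]_(m * n)) :
  ptraceB m n (\sum_e (p e)%:C *: A e) = \sum_e (p e)%:C *: ptraceB m n (A e).
Proof.
apply/matrixP => i i'; rewrite mxE summxE.
under eq_bigr do rewrite summxE; rewrite exchange_big; apply: eq_bigr => e _.
by rewrite !mxE mulr_sumr; apply: eq_bigr => j _; rewrite mxE.
Qed.

Lemma ptraceA_sum k (p : 'I_k -> R) (A : 'I_k -> 'M[C]_(m * n)) :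
  ptraceA m n (\sum_e (p e)%:C *: A e) = \sum_e (p e)%:C *: ptraceA m n (A e).
Proof.
apply/matrixP => i i'; rewrite mxE summxE.
under eq_bigr do rewrite summxE; rewrite exchange_big; apply: eq_bigr => e _.
by rewrite !mxE mulr_sumr; apply: eq_bigr => j _; rewrite mxE.
Qed.

Lemma coeff_mx_unit v : adj v *m v = 1%:M -> \sum_i \sum_j sqn (coeff_mx v i j) = 1.
Proof.
move=> /unit_vectorP <-; rewrite sum_mxvec_index.
by apply: eq_bigr => i _; apply: eq_bigr => j _; rewrite mxE.
Qed.

Lemma vn_entropy_dephase_coeff_mx v :
  vn_entropy (dephase (proj v)) =
  - \sum_i \sum_j sqn (coeff_mx v i j) * ln (sqn (coeff_mx v i j)).
Proof.
rewrite vn_entropy_dephase_proj sum_mxvec_index; congr (- _).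
by apply: eq_bigr => i _; apply: eq_bigr => j _; rewrite mxE.
Qed.

(** The two reduced states of a pure state are equally entropic: exchanging the factors on the left
    gives the transpose of [M *m adj M]. *)
Lemma vn_entropy_mul_adj_tr p q (M : 'M[C]_(p, q)) :
  vn_entropy (M^T *m adj M^T) = vn_entropy (M *m adj M).
Proof.
rewrite vn_entropy_mulC -(vn_entropy_tr (M *m adj M)) trmx_mul; congr vn_entropy.
by congr (_ *m _); apply/matrixP => i j; rewrite !mxE.
Qed.

Lemma vn_entropy_ptraceA_proj_ge0 (v : 'cV[C]_(m * n)) : adj v *m v = 1%:M ->
  0 <= vn_entropy (ptraceA m n (proj v)).
Proof.
move=> /coeff_mx_unit v1; rewrite ptraceA_proj vn_entropy_mul_adj_tr.
apply: vn_entropy_ge0; first exact: psd_mul_adj.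
rewrite /mxtrace; under eq_bigr do rewrite row_norm.
by rewrite -rmorph_sum v1.
Qed.

End Bipartite.

Theorem theorem1 (R : realType) (m n : nat) (rho : 'M[R[i]]_(m * n)) :
  is_state rho ->
  coh_form rho >=
    Num.max (coh_rel (ptraceB m n rho) + coh_form (ptraceA m n rho))
            (coh_rel (ptraceA m n rho) + coh_form (ptraceB m n rho))
    + ent_form m n rho.
Proof.
move=> state_rho; apply: le_roof => // k p psi [p0 p1 psi1 rhoE].
pose M i := coeff_mx (psi i).
have M1 i : \sum_a \sum_b sqn (M i a b) = 1 by apply: coeff_mx_unit.
(* The decomposition chosen for [coh_form] also competes in [ent_form]. *)
have ent_le : ent_form m n rho <= \sum_i p i * vn_entropy (M i *m adj (M i)).
  apply: (le_trans (roof_le (@vn_entropy_ptraceA_proj_ge0 R m n) p0 p1 (fun i _ => psi1 i) rhoE)).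
  by apply: ler_sum => i _; rewrite ptraceA_proj vn_entropy_mul_adj_tr.
have rhoB : ptraceB m n rho = \sum_i (real_complex R (p i)) *: (M i *m adj (M i)).
  by rewrite rhoE ptraceB_sum; apply: eq_bigr => i _; rewrite ptraceB_proj.
have rhoA : ptraceA m n rho = \sum_i (real_complex R (p i)) *: ((M i)^T *m adj (M i)^T).
  by rewrite rhoE ptraceA_sum; apply: eq_bigr => i _; rewrite ptraceA_proj.
under [leRHS]eq_bigr do rewrite vn_entropy_dephase_coeff_mx.
rewrite -lerBrDr ge_max; apply/andP; split; rewrite lerBrDr.
  rewrite rhoA rhoB; apply: le_trans (coherence_splitting p0 p1 M1).
  by rewrite lerD2l.
(* The other entry of the maximum follows from the transposed coefficient matrices; the joint
   entropy and [S] are unchanged. *)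
have MT1 i : \sum_a \sum_b sqn ((M i)^T a b) = 1.
  by rewrite exchange_big -[RHS](M1 i); apply: eq_bigr => a _; apply: eq_bigr => b _; rewrite mxE.
have rhoB' : ptraceB m n rho = \sum_i (real_complex R (p i)) *: ((M i)^T^T *m adj (M i)^T^T).
  by rewrite rhoB; apply: eq_bigr => i _; rewrite trmxK.
have := coherence_splitting p0 p1 MT1; rewrite -rhoA -rhoB' => split_tr.
apply: le_trans (le_trans split_tr _).
  rewrite lerD2l (le_trans ent_le) //.
  by apply: ler_sum => i _; rewrite vn_entropy_mul_adj_tr.
apply: ler_sum => i _; rewrite exchange_big le_eqVlt; apply/orP; left; apply/eqP.
by congr (_ * - _); do 2![apply: eq_bigr => ? _]; rewrite mxE.
Qed.
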